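(* Let $\mathcal{L}$ be a finite congruence-uniform lattice. Then $\mathcal{L}$ is isomorphic (as a poset) to its core label order $\mathrm{CLO}(\mathcal{L})$ if and only if $\mathcal{L}$ is isomorphic to a Boolean lattice $\mathrm{Bool}(n)=(\wp([n]),\subseteq)$ for some $n\in\mathbb{N}$.
   Context: For a finite lattice $\mathcal{L}=(L,\leq)$, $\mathcal{J}(\mathcal{L})$ denotes the set of join-irreducible elements; each $j\in\mathcal{J}(\mathcal{L})$ has a unique lower cover $j_*$. For a cover relation $u\lessdot v$, $\mathrm{cg}(u,v)$ is the finest lattice congruence in which $u,v$ are equivalent, and $\mathrm{cg}(j)=\mathrm{cg}(j_*,j)$; the join-irreducible elements of the congruence lattice are exactly the $\mathrm{cg}(j)$. A finite lattice is congruence-uniform if $j\mapsto\mathrm{cg}(j)$ is a bijection from $\mathcal{J}(\mathcal{L})$ onto the join-irreducible congruences, for both $\mathcal{L}$ and its dual. For a cover $u\lessdot v$, $j_{\mathrm{cg}(u,v)}$ denotes the unique $j\in\mathcal{J}(\mathcal{L})$ with $\mathrm{cg}(j)=\mathrm{cg}(u,v)$. The nucleus of $x$ is $x_\downarrow=\bigwedge\{y\mid y\lessdot x\}$; the core label set is $\Psi(x)=\{j_{\mathrm{cg}(u,v)}\mid x_\downarrow\le u\lessdot v\le x\}$ (empty for $x=\hat0$). The core label order is $\mathrm{CLO}(\mathcal{L})=(L,\sqsubseteq)$ with $x\sqsubseteq y$ iff $\Psi(x)\subseteq\Psi(y)$. $[n]=\{1,\dots,n\}$. *)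

(* Defs.v *)
From HB Require Import structures.
From mathcomp Require Import all_boot all_order.

Set Implicit Arguments.
Unset Strict Implicit.
Unset Printing Implicit Defensive.

Import Order.Theory.
Local Open Scope order_scope.

(* Stated for preorders because the core label order is a partial order only
   when the lattice is congruence-uniform; between partial orders this is the
   usual notion of poset isomorphism. *)
Definition order_isomorphic (d d' : Order.disp_t)
    (P : preorderType d) (Q : preorderType d') : Prop :=
  exists2 f : P -> Q, bijective f & {mono f : x y / x <= y}.

Definition covered_by (d : Order.disp_t) (L : finPOrderType d) (u v : L) : bool :=
  (u < v) && [forall z : L, ~~ (u < z < v)].

Definition join_irreducible (d : Order.disp_t) (L : finTBLatticeType d) :
    {set L} :=
  [set j | (j != \bot) &&
           [forall x, forall y, (j == x `|` y) ==> (j == x) || (j == y)]].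

(* For a join-irreducible [j], this is the unique lower cover of [j]; the
   default value [j] is only used when [j] has no lower cover. *)
Definition lower_cover (d : Order.disp_t) (L : finTBLatticeType d) (j : L) : L :=
  odflt j [pick u | covered_by u j].

Definition is_congruence (d : Order.disp_t) (L : finLatticeType d)
    (R : {set L * L}) : bool :=
  [&& [forall x, (x, x) \in R],
      [forall x, forall y, ((x, y) \in R) ==> ((y, x) \in R)],
      [forall x, forall y, forall z,
         ((x, y) \in R) ==> ((y, z) \in R) ==> ((x, z) \in R)],
      [forall x, forall x', forall y, forall y',
         ((x, x') \in R) ==> ((y, y') \in R) ==>
         ((x `&` y, x' `&` y') \in R)] &
      [forall x, forall x', forall y, forall y',
         ((x, x') \in R) ==> ((y, y') \in R) ==>
         ((x `|` y, x' `|` y') \in R)]].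

Record congruence (d : Order.disp_t) (L : finLatticeType d) : Type :=
  Congruence { con_graph :> {set L * L}; conP : is_congruence con_graph }.

Section CongruenceLattice.
Context (d : Order.disp_t) (L : finLatticeType d).
Local Notation con := (congruence L).

HB.instance Definition _ := [isSub for @con_graph d L].
HB.instance Definition _ := [Finite of con by <:].

Lemma is_congruenceP (R : {set L * L}) :
  reflect [/\ forall x, (x, x) \in R,
              forall x y, (x, y) \in R -> (y, x) \in R,
              forall x y z, (x, y) \in R -> (y, z) \in R -> (x, z) \in R,
              forall x x' y y', (x, x') \in R -> (y, y') \in R ->
                (x `&` y, x' `&` y') \in R &
              forall x x' y y', (x, x') \in R -> (y, y') \in R ->
                (x `|` y, x' `|` y') \in R]
          (is_congruence R).
Proof.
apply: (iffP and5P) => -[r s t m j]; split.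
- exact/forallP.
- by move=> x y; apply/implyP; move/forallP/(_ x)/forallP: s; apply.
- move=> x y z xy yz; move/forallP/(_ x)/forallP/(_ y)/forallP/(_ z): t.
  by rewrite xy yz.
- move=> x x' y y' xx yy.
  move/forallP/(_ x)/forallP/(_ x')/forallP/(_ y)/forallP/(_ y'): m.
  by rewrite xx yy.
- move=> x x' y y' xx yy.
  move/forallP/(_ x)/forallP/(_ x')/forallP/(_ y)/forallP/(_ y'): j.
  by rewrite xx yy.
- exact/forallP.
- by do 2!apply/forallP => ?; apply/implyP; apply: s.
- by do 3!apply/forallP => ?; do 2!apply/implyP => ?; apply: t; eassumption.
- by do 4!apply/forallP => ?; do 2!apply/implyP => ?; apply: m.
- by do 4!apply/forallP => ?; do 2!apply/implyP => ?; apply: j.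
Qed.

Lemma is_congruence_bigcap (P : pred con) :
  is_congruence (\bigcap_(t : con | P t) con_graph t).
Proof.
apply/is_congruenceP; split.
- by move=> x; apply/bigcapP => t _; case/is_congruenceP: (conP t).
- move=> x y /bigcapP xy; apply/bigcapP => t Pt.
  by case/is_congruenceP: (conP t) => _ s _ _ _; apply: s; apply: xy.
- move=> x y z /bigcapP xy /bigcapP yz; apply/bigcapP => t Pt.
  case/is_congruenceP: (conP t) => _ _ tr _ _.
  by apply: (tr _ y); [apply: xy | apply: yz].
- move=> x x' y y' /bigcapP xx /bigcapP yy; apply/bigcapP => t Pt.
  case/is_congruenceP: (conP t) => _ _ _ m _.
  by apply: m; [apply: xx | apply: yy].
- move=> x x' y y' /bigcapP xx /bigcapP yy; apply/bigcapP => t Pt.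
  case/is_congruenceP: (conP t) => _ _ _ _ j.
  by apply: j; [apply: xx | apply: yy].
Qed.

Definition con_bigcap (P : pred con) : con :=
  Congruence (is_congruence_bigcap P).

Definition con_le (s t : con) : bool := con_graph s \subset con_graph t.

Lemma con_le_refl : reflexive con_le.
Proof. by move=> t; apply: subxx. Qed.

Lemma con_le_anti : antisymmetric con_le.
Proof. by move=> s t /andP[st ts]; apply/val_inj/eqP; rewrite eqEsubset; apply/andP. Qed.

Lemma con_le_trans : transitive con_le.
Proof. by move=> t s u; apply: subset_trans. Qed.

Fact congruence_display : Order.disp_t. Proof. exact: Order.Disp tt tt. Qed.

HB.instance Definition _ := Order.Le_isPOrder.Build congruence_display con
  con_le_refl con_le_anti con_le_trans.

Definition con_meet (s t : con) : con :=
  con_bigcap (fun r => (r == s) || (r == t)).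

Definition con_join (s t : con) : con :=
  con_bigcap (fun r => con_le s r && con_le t r).

Lemma con_le_bigcap (P : pred con) (s : con) :
  (s <= con_bigcap P) = [forall (r | P r), s <= r].
Proof.
apply/bigcapsP/forall_inP => h r Pr; exact: h.
Qed.

Lemma con_meetP (r s t : con) : (r <= con_meet s t) = (r <= s) && (r <= t).
Proof.
rewrite con_le_bigcap; apply/forall_inP/andP => [h|[rs rt] q /orP[]/eqP->//].
by split; apply: h; rewrite eqxx ?orbT.
Qed.

Lemma con_joinP (r s t : con) : (con_join r s <= t) = (r <= t) && (s <= t).
Proof.
apply/idP/andP => [h|[rt st]].
  by split; apply: le_trans h; rewrite con_le_bigcap;
     apply/forall_inP => q /andP[].
by apply: bigcap_inf; apply/andP.
Qed.

HB.instance Definition _ :=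
  Order.POrder_MeetJoin_isLattice.Build congruence_display con
    con_meetP con_joinP.

Definition con_bot : con := con_bigcap predT.

Lemma con_le0x (t : con) : con_bot <= t.
Proof. exact: bigcap_inf. Qed.

Lemma is_congruence_setT : is_congruence [set: L * L].
Proof. by apply/is_congruenceP; split=> *; rewrite inE. Qed.

Definition con_top : con := Congruence is_congruence_setT.

Lemma con_lex1 (t : con) : t <= con_top.
Proof. exact: subsetT. Qed.

HB.instance Definition _ :=
  Order.hasBottom.Build congruence_display con con_le0x.
HB.instance Definition _ :=
  Order.hasTop.Build congruence_display con con_lex1.

End CongruenceLattice.

(* The finest congruence identifying [u] and [v]. *)
Definition cg (d : Order.disp_t) (L : finLatticeType d) (u v : L) :
    congruence L :=
  \meet_(t : congruence L | (u, v) \in con_graph t) t.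

Definition cgj (d : Order.disp_t) (L : finTBLatticeType d) (j : L) :
    congruence L :=
  cg (lower_cover j) j.

Definition cg_bijective (d : Order.disp_t) (L : finTBLatticeType d) : Prop :=
  {in join_irreducible L &, injective (@cgj d L)} /\
  [set cgj j | j in join_irreducible L] = join_irreducible (congruence L).

Definition congruence_uniform (d : Order.disp_t) (L : finTBLatticeType d) :
    Prop :=
  cg_bijective L /\ cg_bijective L^d.

(* For [u] covered by [v] in a congruence-uniform lattice, this is the unique
   join-irreducible [j] with [cgj j = cg u v]; the default value [\bot] is then
   never used. *)
Definition cover_label (d : Order.disp_t) (L : finTBLatticeType d) (u v : L) :
    L :=
  odflt \bot [pick j in join_irreducible L | cgj j == cg u v].

Definition nucleus (d : Order.disp_t) (L : finTBLatticeType d) (x : L) : L :=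
  \meet_(y | covered_by y x) y.

(* The nucleus of [\bot] is the empty meet [\top], so that the core label set
   of [\bot] is empty; see [core_labels_bot]. *)
Definition core_labels (d : Order.disp_t) (L : finTBLatticeType d) (x : L) :
    {set L} :=
  [set cover_label u v | u in L, v in L &
     [&& nucleus x <= u, covered_by u v & v <= x]].

Lemma core_labels_bot (d : Order.disp_t) (L : finTBLatticeType d) :
  core_labels (\bot : L) = set0.
Proof.
apply/setP=> j; rewrite inE; apply/negP => /imset2P[u v _].
rewrite inE => /and4P[_ _ /andP[uv _]]; rewrite lex0 => /eqP v0.
by rewrite v0 ltx0 in uv.
Qed.

(* The core label order: a copy of [L] with its own order relation. *)
Definition CLO (d : Order.disp_t) (L : finTBLatticeType d) : Type := L.

Section CoreLabelOrder.
Context (d : Order.disp_t) (L : finTBLatticeType d).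

HB.instance Definition _ := Finite.on (CLO L).

Definition clo_le (x y : CLO L) : bool :=
  core_labels (x : L) \subset core_labels (y : L).

Lemma clo_le_refl : reflexive clo_le.
Proof. by move=> x; apply: subxx. Qed.

Lemma clo_le_trans : transitive clo_le.
Proof. by move=> y x z; apply: subset_trans. Qed.

Fact clo_display : Order.disp_t. Proof. exact: Order.Disp tt tt. Qed.

HB.instance Definition _ :=
  Order.Le_isPreorder.Build clo_display (CLO L) clo_le_refl clo_le_trans.

End CoreLabelOrder.

(* Makes inclusion the canonical order on [{set T}]. *)
Import Order.DefaultSetSubsetOrder.

Definition Bool (n : nat) : finTBLatticeType _ := {set 'I_n}.

(* Main.v *)
(** Suppose [L] is isomorphic to its core label order.  A join-irreducible [j]
   has [core_labels j = [set j]], hence is an atom of the core label order; the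
   isomorphism therefore injects the join-irreducibles of [L] into its atoms,
   and every join-irreducible is an atom.  Every element maximal among those not
   above an atom [a] is meet-irreducible and spans the congruence [cg \bot a],
   so injectivity of [cgj] on the dual makes it unique: the elements not above
   [a] are closed under join.  Hence an atom below a join of atoms is one of
   them, and sending [x] to the set of atoms below it is an isomorphism onto
   the power set of the atoms.  Conversely, in a
   Boolean lattice [core_labels x] is the set of atoms below [x], and the
   identity is an isomorphism. *)
Require Import Defs.
From mathcomp Require Import all_boot all_order.

Set Implicit Arguments.
Unset Strict Implicit.
Unset Printing Implicit Defensive.

Import Order.Theory.
Local Open Scope order_scope.

(** * Extremal elements and covers in finite posets *)

Section FinPOrder.
Context (d : Order.disp_t) (L : finPOrderType d).
Implicit Types (P : pred L) (x y z : L).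

(** Down-set cardinality is a strictly monotone rank; minimizing or maximizing it yields minimal or
    maximal elements. *)
Lemma card_downset_lt x y :
  x < y -> (#|[set z | (z <= x)%O]| < #|[set z | (z <= y)%O]|)%N.
Proof.
move=> xy; apply/proper_card/properP; split.
  by apply/subsetP => z; rewrite !inE => /le_trans -> //; apply: ltW.
by exists y; rewrite !inE ?lexx // lt_geF.
Qed.

Lemma ex_minimal P x : P x -> exists2 z, P z & forall u, u < z -> ~~ P u.
Proof.
move=> Px; case: (arg_minnP (fun z => #|[set w | (w <= z)%O]|) Px) => z Pz zmin.
by exists z => // u uz; apply/negP => /zmin; rewrite leqNgt card_downset_lt.
Qed.

Lemma ex_maximal P x : P x -> exists2 z, P z & forall u, z < u -> ~~ P u.
Proof.
move=> Px; case: (arg_maxnP (fun z => #|[set w | (w <= z)%O]|) Px) => z Pz zmax.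
by exists z => // u zu; apply/negP => /zmax; rewrite /geq /= leqNgt card_downset_lt.
Qed.

Lemma covered_byP x y :
  reflect (x < y /\ forall z, x <= z -> z < y -> z = x) (covered_by x y).
Proof.
apply: (iffP andP) => -[xy h]; split=> //.
  move=> z xz zy; move/forallP/(_ z): h; rewrite zy andbT lt_neqAle xz andbT.
  by rewrite negbK => /eqP.
apply/forallP => z; apply/negP => /andP[xz zy].
by move: (xz); rewrite (h z (ltW xz) zy) ltxx.
Qed.

End FinPOrder.

(** A congruence containing one pair contains the other: joining with [x] carries the left pair to
    the right one, and meeting with [y] carries it back. *)
Lemma cg_perspective (d : Order.disp_t) (L : finLatticeType d) (x y : L) :
  cg (x `&` y) y = cg x (x `|` y).
Proof.
apply: eq_bigl => t; case/is_congruenceP: (conP t) => r _ _ m j.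
apply/idP/idP => h.
  by have := j _ _ _ _ (r x) h; rewrite meetKU.
by have := m _ _ _ _ h (r y); rewrite [(x `|` y) `&` y]meetC joinKIC.
Qed.

(** * Join-irreducible elements, their congruences and their core labels *)

Section JoinIrreducible.
Context (d : Order.disp_t) (L : finTBLatticeType d).
Implicit Types (x y z j a c : L).

Lemma join_irreducibleP j :
  reflect (j != \bot /\ forall x y, j = x `|` y -> j = x \/ j = y)
          (j \in join_irreducible L).
Proof.
rewrite inE; apply: (iffP andP) => -[j0 h]; split=> //.
  move=> x y jxy; move/forallP/(_ x)/forallP/(_ y): h.
  by rewrite -jxy eqxx => /orP[]/eqP; [left|right].
apply/forallP => x; apply/forallP => y; apply/implyP => /eqP /h.
by case=> /eqP ->; rewrite ?orbT.
Qed.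

Lemma covered_bot_join_irreducible a :
  covered_by \bot a -> a \in join_irreducible L.
Proof.
move=> /covered_byP[a0 amin]; apply/join_irreducibleP; split.
  by rewrite -lt0x.
move=> x y axy; have [->|ax] := eqVneq a x; [by left | right].
have x0 : x = \bot by apply: amin; rewrite ?le0x // lt_def ax axy leUl.
by rewrite axy x0 join0x.
Qed.

Lemma lower_cover_covered_by j : j != \bot -> covered_by (lower_cover j) j.
Proof.
rewrite -lt0x => j0; rewrite /lower_cover; case: pickP => //= none.
have [z zj zmax] := ex_maximal (P := fun z => (z < j)%O) j0.
have /negP[] := none z; apply/covered_byP; split=> // u zu uj.
by apply/eqP; rewrite eq_sym;
  apply: contraLR uj => nzu; apply: zmax; rewrite lt_neqAle nzu.
Qed.

(** [lower_cover] only picks some lower cover. By irreducibility its join with [x] stays strictly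
    below [j], hence equals that cover, which is therefore unique. *)
Lemma join_irreducible_lt j x :
  j \in join_irreducible L -> x < j -> x <= lower_cover j.
Proof.
move=> /join_irreducibleP[j0 jirr] xj.
have /covered_byP[uj umax] := lower_cover_covered_by j0.
apply: contraTT xj => nxu; have [] := boolP (lower_cover j `|` x < j).
  move=> h; move: nxu; rewrite -(umax _ _ h) ?leUl //.
  by rewrite leUr.
rewrite lt_neqAle negb_and negbK leUx (ltW uj) /= => /orP[/eqP E|].
  have [E'|->] := jirr _ _ (esym E); last by rewrite ltxx.
  by move: uj; rewrite -E' ltxx.
by apply: contraNN => /ltW.
Qed.

(** Take [j] minimal among the elements below [x] and not below [c]. Were [j] a join of two strictly
    smaller elements, both would lie below [c], and so would [j]. *)
Lemma ex_minimal_join_irreducible x c : ~~ (x <= c) ->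
  exists j, [/\ j \in join_irreducible L, j <= x, ~~ (j <= c) &
                forall u, u < j -> u <= c].
Proof.
move=> xc; have [|j /andP[jx jc] jmin] :=
  ex_minimal (P := fun z => (z <= x) && ~~ (z <= c)) (x := x).
  by rewrite lexx.
have below u : u < j -> u <= c.
  by move=> uj; move: (jmin u uj); rewrite (le_trans (ltW uj) jx) negbK.
exists j; split=> //; apply/join_irreducibleP; split.
  by apply: contraNneq jc => ->; rewrite le0x.
move=> y z jyz; have [->|jy] := eqVneq j y; first by left.
have [->|jz] := eqVneq j z; first by right.
case/negP: jc; rewrite jyz leUx !below // lt_def ?jy ?jz jyz ?leUl ?leUr //.
Qed.

Lemma le_join_irreducible x y :
  (forall j, j \in join_irreducible L -> j <= x -> j <= y) -> x <= y.
Proof.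
move=> h; apply/negPn/negP => /ex_minimal_join_irreducible[j [jJ jx jy _]].
by rewrite h in jy.
Qed.

(** A minimal [j] not below the coatom [c] joins with [c] to [\top] and meets it in its lower cover,
    so perspectivity gives [cgj j = cg c \top]. Injectivity leaves one such [j], which is then below
    both [x] and [y]. *)
Lemma meet_not_le_coatom c x y :
  {in join_irreducible L &, injective (@cgj d L)} -> covered_by c \top ->
  ~~ (x <= c) -> ~~ (y <= c) -> ~~ (x `&` y <= c).
Proof.
move=> cg_inj /covered_byP[c1 cmax] xc yc.
have cgE j : j \in join_irreducible L -> ~~ (j <= c) ->
    (forall u, u < j -> u <= c) -> cgj j = cg c \top.
  move=> jJ jc jmin; rewrite /cgj.
  have cj : c `|` j = \top.
    apply/eqP; apply: contraNT jc; rewrite -ltx1 => /(cmax _ (leUl _ _)) <-.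
    exact: leUr.
  have ltj : c `&` j < j.
    by rewrite lt_neqAle leIr andbT; apply: contraNneq jc => <-; rewrite leIl.
  have -> : lower_cover j = c `&` j.
    apply: le_anti; rewrite join_irreducible_lt // andbT.
    have /join_irreducibleP[/lower_cover_covered_by/covered_byP[lj _] _] := jJ.
    by rewrite lexI (jmin _ lj) ltW.
  by rewrite cg_perspective cj.
have [j [jJ jx jc jmin]] := ex_minimal_join_irreducible xc.
have [k [kJ ky kc kmin]] := ex_minimal_join_irreducible yc.
have jk : j = k by apply: cg_inj; rewrite // !cgE.
by apply: contraNN jc => /(le_trans _) -> //; rewrite lexI jx jk.
Qed.

Lemma cover_labelE u v j :
  {in join_irreducible L &, injective (@cgj d L)} ->
  j \in join_irreducible L -> cg u v = cgj j -> cover_label u v = j.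
Proof.
move=> cg_inj jJ E; rewrite /cover_label; case: pickP => [k|/(_ j)].
  by case/andP=> kJ /eqP; rewrite E => /cg_inj; apply.
by rewrite E jJ eqxx.
Qed.

Lemma nucleus_le x y : covered_by y x -> nucleus x <= y.
Proof. exact: (@meets_inf _ _ _ y (fun z => covered_by z x) id). Qed.

(** The nucleus of [j] is its unique lower cover, so the core interval contains a single cover
    relation, labelled by [j] itself. *)
Lemma core_labels_join_irreducible j :
  {in join_irreducible L &, injective (@cgj d L)} ->
  j \in join_irreducible L -> core_labels j = [set j].
Proof.
move=> cg_inj jJ; have /join_irreducibleP[j0 _] := jJ.
have lcov := lower_cover_covered_by j0; have /covered_byP[lj lmax] := lcov.
have nucE : nucleus j = lower_cover j.
  apply: le_anti; rewrite (nucleus_le lcov) /=.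
  by apply: meets_ge => y /covered_byP[yj ymax];
    rewrite (ymax (lower_cover j)) ?join_irreducible_lt.
apply/setP => k; rewrite inE; apply/imset2P/eqP => [[u v _]|->].
  rewrite inE => /and4P[_]; rewrite nucE => lu /covered_byP[uv umax] vj ->.
  have uE := lmax _ lu (lt_le_trans uv vj); rewrite uE in uv *.
  apply: cover_labelE; rewrite // /cgj.
  suff -> : v = j by [].
  move: vj; rewrite le_eqVlt => /predU1P[//|/lmax E].
  by move: (uv); rewrite (E (ltW uv)) ltxx.
exists (lower_cover j) j; rewrite ?inE ?nucE ?lexx ?lcov //.
by rewrite (cover_labelE (j := j)).
Qed.

Lemma clo_iso_atomistic :
  {in join_irreducible L &, injective (@cgj d L)} ->
  order_isomorphic L (CLO L) ->
  {in join_irreducible L, forall j, covered_by \bot j}.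
Proof.
move=> cg_inj [f [g fK gK] f_mono].
have leE x y : (g x <= g y) = (core_labels x \subset core_labels y).
  by rewrite -f_mono !gK.
have g_inj : injective g := can_inj gK.
have g0 : g (\bot : L) = \bot.
  apply/eqP; rewrite -lex0 -[\bot in X in _ <= X]fK leE core_labels_bot.
  exact: sub0set.
have g_atom j : j \in join_irreducible L -> covered_by \bot (g j).
  move=> jJ; have /join_irreducibleP[j0 _] := jJ.
  apply/covered_byP; split.
    by rewrite lt0x -g0; apply: contraNneq j0 => /g_inj ->.
  move=> z _ zj; rewrite -[z]fK in zj *.
  have := ltW zj; rewrite leE (core_labels_join_irreducible cg_inj jJ) subset1.
  (* If the label set is all of [[set j]], antisymmetry is applied to the images under [g] in [L],
     because [CLO L] is only known to be a preorder. *)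
  move=> /orP[]/eqP E.
    move: zj; rewrite lt_neqAle leE => /andP[/negP[]].
    apply/eqP/le_anti; rewrite !leE.
    by rewrite (core_labels_join_irreducible cg_inj jJ) E subxx.
  by apply/eqP; rewrite -lex0 -g0 leE E sub0set.
(* Atoms are join-irreducible, so [g] maps a finite set injectively into itself and hence onto
   itself. *)
have imE : g @: join_irreducible L = join_irreducible L.
  apply/eqP; rewrite eqEcard card_imset // leqnn andbT.
  apply/subsetP => _ /imsetP[j jJ ->].
  exact/covered_bot_join_irreducible/g_atom.
by move=> j; rewrite -imE => /imsetP[k kJ ->]; apply: g_atom.
Qed.

(** The second hypothesis says that atoms are join-prime. The maps [atoms] and [sup] are inverse:
    one direction holds because join-irreducibles determine elements, the other by primeness. *)
Lemma atomistic_boolean :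
  {in join_irreducible L, forall j, covered_by \bot j} ->
  (forall a x y, covered_by \bot a -> ~~ (a <= x) -> ~~ (a <= y) ->
     ~~ (a <= x `|` y)) ->
  order_isomorphic L (Bool #|join_irreducible L|).
Proof.
move=> atomic prime; set J := join_irreducible L.
pose atoms x : {set 'I_#|J|} := [set i | (enum_val i <= x)%O].
pose sup (S : {set 'I_#|J|}) := \join_(i in S) enum_val i : L.
have atomsK : cancel atoms sup.
  move=> x; apply: le_anti; apply/andP; split.
    by apply: joins_le => i; rewrite inE.
  apply: le_join_irreducible => j jJ jx; rewrite -(enum_rankK_in jJ jJ).
  by apply: (joins_sup enum_val); rewrite inE enum_rankK_in.
have supK : cancel sup atoms.
  move=> S; apply/setP => i; rewrite inE; apply/idP/idP; last first.
    by move=> iS; apply: (joins_sup enum_val).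
  have iJ := enum_valP i; have iat := atomic _ iJ.
  have /covered_byP[i0 _] := iat.
  apply: contraTT => iS; rewrite /sup.
  (* Not lying above a fixed atom is preserved by joins, so it passes from the atoms indexed by [S]
     to their join. *)
  apply: (big_ind (fun z => ~~ (enum_val i <= z))) => [|x y|k kS].
  - by rewrite lex0 -lt0x i0.
  - exact: prime.
  have /covered_byP[_ kmin] := atomic _ (enum_valP k).
  apply: contraNN iS; rewrite le_eqVlt => /predU1P[/enum_val_inj -> //|].
  by move=> /(kmin _ (le0x _)) E; move: i0; rewrite E ltxx.
exists atoms; first by exists sup.
move=> x y; rewrite -[in RHS](atomsK x).
apply/subsetP/idP => [sub|sub i].
  by apply: joins_le => i /sub; rewrite inE.
by rewrite !inE => ix; apply: le_trans sub; apply: (joins_sup enum_val); rewrite inE.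
Qed.

End JoinIrreducible.

(** This is the coatom result read in [L^d], where the atom [a] becomes a coatom. *)
Lemma join_not_ge_atom (d : Order.disp_t) (L : finTBLatticeType d) (a x y : L) :
  {in join_irreducible L^d &, injective (@cgj _ L^d)} -> covered_by \bot a ->
  ~~ (a <= x) -> ~~ (a <= y) -> ~~ (a <= x `|` y).
Proof.
move=> cg_inj /covered_byP[a0 amin].
apply: (@meet_not_le_coatom _ L^d a x y cg_inj).
apply/covered_byP; split; first exact: a0.
move=> z za z0; apply/eqP; move: za; rewrite le_eqVlt eq_sym => /orP[//|za].
by move: z0; rewrite [z](amin _ (le0x _) za) ltxx.
Qed.

(** * Core labels in a complemented distributive lattice *)

Section BooleanCoreLabels.
Context (d : Order.disp_t) (L : finTBLatticeType d) (compl : L -> L).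
Implicit Types (x y z j : L).
Hypothesis meetUl : forall x y z, (x `|` y) `&` z = (x `&` z) `|` (y `&` z).
Hypothesis meet_compl : forall x, x `&` compl x = \bot.
Hypothesis join_compl : forall x, x `|` compl x = \top.
Hypothesis cg_inj : {in join_irreducible L &, injective (@cgj d L)}.

Let splitE x z : x = (z `&` x) `|` (compl z `&` x).
Proof. by rewrite -meetUl join_compl meet1x. Qed.

(** Split [j] along some [z < j] and its complement. Irreducibility puts [j] below one of the two;
    it must be [compl z], whence [z] is below its own complement. *)
Lemma complemented_atomistic j :
  j \in join_irreducible L -> covered_by \bot j.
Proof.
move=> /join_irreducibleP[j0 jirr]; apply/covered_byP; rewrite lt0x; split=> //.
move=> z _ zj; have [E|E] := jirr _ _ (splitE j z).
  by move: (lt_geF zj); rewrite E leIl.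
apply/eqP; rewrite -lex0 -(meet_compl z) lexI lexx.
by rewrite (le_trans (ltW zj)) // E leIl.
Qed.

(** For an atom [j] below [x], the meet of [compl j] and [x] is a lower cover of [x]. An atom below
    the nucleus would thus be below its own complement. *)
Lemma complemented_nucleus x : x != \bot -> nucleus x = \bot.
Proof.
move=> x0; apply/eqP; rewrite -lex0; apply: le_join_irreducible => j jJ jn.
have /covered_byP[j0 jmin] := complemented_atomistic jJ.
have jx : j <= x.
  apply: le_trans jn _; have lc := lower_cover_covered_by x0.
  by apply: (le_trans (nucleus_le lc)); case/andP: lc => /ltW.
suff cov : covered_by (compl j `&` x) x.
  rewrite -(meet_compl j) lexI lexx (le_trans jn) //.
  by apply: (le_trans (nucleus_le cov)); rewrite leIl.
apply/covered_byP; split.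
  rewrite lt_neqAle leIr andbT; apply: contraTneq j0 => E.
  rewrite lt0x negbK -lex0 -(meet_compl j) lexI lexx.
  by rewrite (le_trans jx) // -E leIl.
move=> z uz zx; apply/le_anti; rewrite uz andbT {1}(splitE z j) leUx.
rewrite [X in _ && X]leI2 ?lexx ?(ltW zx) // andbT.
have [E|] := boolP (j `&` z == j).
  move: (lt_geF zx); rewrite {1}(splitE x j) leUx uz andbT.
  by rewrite leIxl //; apply/meet_idPl/eqP.
move=> E; rewrite (jmin (j `&` z)) ?le0x //.
by rewrite lt_neqAle E leIl.
Qed.

Lemma complemented_core_labels x :
  core_labels x = [set j in join_irreducible L | (j <= x)%O].
Proof.
apply/setP => k; rewrite [RHS]inE; apply/imset2P/andP => [[u v _]|[kJ kx]].
  rewrite inE => /and4P[_ _ /covered_byP[uv umax] vx ->].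
  have : ~~ (v <= u) by rewrite lt_geF.
  move=> /ex_minimal_join_irreducible[j [jJ jv ju jmin]].
  (* The atom [j] meets [u] in [\bot] and joins with it to [v], so the cover is perspective to
     [\bot] below [j]. *)
  suff -> : cover_label u v = j by split=> //; apply: le_trans vx.
  apply: cover_labelE => //.
  have /covered_byP[j0 j0min] := complemented_atomistic jJ.
  have /join_irreducibleP[nj0 _] := jJ.
  have /covered_byP[lj _] := lower_cover_covered_by nj0.
  rewrite /cgj (j0min _ (le0x _) lj).
  have -> : \bot = u `&` j.
    apply/esym/j0min; rewrite ?le0x // lt_neqAle leIr andbT.
    by apply: contraNneq ju => <-; rewrite leIl.
  rewrite cg_perspective; congr cg; apply/esym/eqP.
  apply: contraNT ju => ne; rewrite -(umax (u `|` j)) ?leUl ?leUr //.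
  by rewrite lt_neqAle ne leUx jv ltW.
have kcov := complemented_atomistic kJ; have /covered_byP[k0 kmin] := kcov.
(* Needed because the nucleus of [\bot] is [\top]; for other [x] the core interval starts at [\bot]
   and contains the cover of [\bot] by [k]. *)
have x0 : x != \bot by rewrite -lt0x (lt_le_trans k0).
exists \bot k; rewrite // ?inE ?complemented_nucleus ?lexx ?kcov //.
rewrite (cover_labelE (j := k)) // /cgj.
have /join_irreducibleP[nk0 _] := kJ.
have /covered_byP[lk _] := lower_cover_covered_by nk0.
by rewrite (kmin _ (le0x _) lk).
Qed.

Lemma complemented_clo_iso : order_isomorphic L (CLO L).
Proof.
exists id; first by exists id.
move=> x y; rewrite /Order.le /= /clo_le !complemented_core_labels.
apply/subsetP/idP => [sub|xy j].
  apply: le_join_irreducible => j jJ jx.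
  have /sub : j \in [set k in join_irreducible L | (k <= x)%O] by rewrite inE jJ.
  by rewrite inE => /andP[].
by rewrite !inE => /andP[-> /le_trans ->].
Qed.

End BooleanCoreLabels.

(** * Order isomorphisms preserve meets and joins *)

Section OrderIsomorphism.
Context (d d' : Order.disp_t) (L : latticeType d) (M : latticeType d').
Context (f : L -> M) (g : M -> L).
Hypotheses (gK : cancel g f) (f_mono : {mono f : x y / x <= y}).

Let le_g x y : (x <= g y) = (f x <= y).
Proof. by rewrite -f_mono gK. Qed.

Let g_le x y : (g y <= x) = (y <= f x).
Proof. by rewrite -f_mono gK. Qed.

Lemma order_iso_meet x y : f (x `&` y) = f x `&` f y.
Proof.
apply: le_anti; rewrite lexI !f_mono leIl leIr /= -g_le lexI !g_le.
by rewrite leIl leIr.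
Qed.

Lemma order_iso_join x y : f (x `|` y) = f x `|` f y.
Proof.
apply: le_anti; rewrite leUx !f_mono leUl leUr andbT -le_g leUx !le_g.
by rewrite leUl leUr.
Qed.

End OrderIsomorphism.

Theorem theorem1p5 (d : Order.disp_t) (L : finTBLatticeType d) :
  congruence_uniform L ->
  (order_isomorphic L (CLO L) <-> exists n : nat, order_isomorphic L (Bool n)).
Proof.
move=> [[cg_inj _] [cg_inj_dual _]]; split=> [iso|[n [f [g fK gK] f_mono]]].
  exists #|join_irreducible L|; apply: atomistic_boolean.
    exact: clo_iso_atomistic.
  by move=> a x y; apply: join_not_ge_atom.
have fI := order_iso_meet gK f_mono.
have fU := order_iso_join gK f_mono.
have f_inj := can_inj fK.
(* The complement on [L] is set complement transported along the isomorphism. *)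
apply: (@complemented_clo_iso _ _ (fun x => g (~: (f x : {set 'I_n})))) => //.
- by move=> x y z; apply: f_inj; rewrite !(fI, fU); apply: setIUl.
- move=> x; apply/eqP; rewrite -lex0 -f_mono fI gK.
  have -> : f x `&` (~: (f x : {set 'I_n})) = set0 := setICr _.
  exact: sub0set.
- move=> x; apply/eqP; rewrite -le1x -f_mono fU gK.
  have -> : f x `|` (~: (f x : {set 'I_n})) = setT := setUCr _.
  exact: subsetT.
Qed.
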